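(* Let $\mathcal{H}$ be a complex Hilbert space and let $\mathbf{T}=(T_1,T_2)$ be a commuting pair of bounded linear operators on $\mathcal{H}$ which is a left-inverse commuting, analytic toral $2$-isometry. Put $\ker\mathbf{T}^*:=\ker T_1^*\cap\ker T_2^*$ and assume that $T_j^*T_j(\ker\mathbf{T}^* )\subseteq\ker\mathbf{T}^*$ for $j=1,2$. Then $$T_1^mT_2^n(\ker\mathbf{T}^* )\perp T_1^pT_2^q(\ker\mathbf{T}^* )\quad\text{whenever }(m,n),(p,q)\in\mathbb{Z}_+^2\text{ and }(m,n)\neq(p,q).$$
   Context: $\mathbb{Z}_+$ is the set of nonnegative integers. A commuting pair $(T_1,T_2)$ of bounded operators is a toral $2$-isometry if $I-T_i^*T_i-T_j^*T_j+T_j^*T_i^*T_iT_j=0$ for all $i,j\in\{1,2\}$ (including $i=j$). In this case each $T_i$ is left-invertible, i.e. $T_i^*T_i$ is invertible. A commuting pair $(T_1,T_2)$ of left-invertible operators is left-inverse commuting if $L_iT_j=T_jL_i$ for $1\le i\ne j\le 2$, where $L_j:=(T_j^*T_j)^{-1}T_j^*$. A commuting pair $\mathbf{T}=(T_1,T_2)$ on $\mathcal{H}$ is analytic if $\bigcap_{(m,n)\in\mathbb{Z}_+^2}T_1^mT_2^n(\mathcal{H})=\{0\}$. *)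

(* Defs.v *)
From HB Require Import structures.
From mathcomp Require Import all_boot all_order all_algebra.
From mathcomp Require Import complex.
From mathcomp Require Import all_classical all_reals all_analysis.

Set Implicit Arguments.
Unset Strict Implicit.
Unset Printing Implicit Defensive.

Import Order.TTheory GRing.Theory Num.Theory Num.Def.
Import numFieldNormedType.Exports.

Local Open Scope classical_set_scope.
Local Open Scope complex_scope.
Local Open Scope ring_scope.

(* The inner product is linear in its first argument and conjugate-linear in
   the second. *)
Structure hilbertSpace (R : realType) := HilbertSpace {
  hilbert_sort :> completeNormedModType R[i] ;
  inner : {dot hilbert_sort for conjC} ;
  inner_norm : forall x : hilbert_sort, `|x| ^+ 2 = inner x x
}.

Notation "''[' x , y ]" := (inner _ x y) : ring_scope.

Section Operators.
Variables (R : realType) (H : hilbertSpace R).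

(* For linear maps, boundedness near 0 is the existence of M with
   |A x| <= M |x| for all x (see linear_boundedP). *)
Definition bounded_operator (A : {linear H -> H}) : Prop :=
  bounded_near A (nbhs (0 : H)).

(* The value is unique when it exists, by nondegeneracy of the inner product,
   and it exists for every bounded A by the Riesz representation theorem. *)
Definition adjoint (A : H -> H) : H -> H :=
  xget (fun=> 0) [set B : H -> H | forall x y : H, '[A x, y] = '[x, B y]].

Definition invertible (A : H -> H) : Prop :=
  exists B : {linear H -> H}, [/\ bounded_operator B, cancel A B & cancel B A].

Definition op_inverse (A : H -> H) : H -> H :=
  xget (fun=> 0) [set B : H -> H | cancel A B /\ cancel B A].

Definition left_invertible (A : H -> H) : Prop := invertible (adjoint A \o A).

Definition left_inverse (A : H -> H) : H -> H :=
  op_inverse (adjoint A \o A) \o adjoint A.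

Definition ker (A : H -> H) : set H := A @^-1` [set 0].

Definition perp (A B : set H) : Prop :=
  forall x y : H, A x -> B y -> '[x, y] = 0.

(* A pair (T_1, T_2) is a family indexed by 'I_2: T_1 is T 0 and T_2 is T 1. *)
Implicit Type T : 'I_2 -> {linear H -> H}.

Definition commuting_pair T : Prop :=
  forall i j : 'I_2, T i \o T j = T j \o T i.

Definition toral_2_isometry T : Prop :=
  forall (i j : 'I_2) (x : H),
    x - adjoint (T i) (T i x) - adjoint (T j) (T j x)
      + adjoint (T j) (adjoint (T i) (T i (T j x))) = 0.

Definition left_inverse_commuting T : Prop :=
  (forall i : 'I_2, left_invertible (T i)) /\
  (forall i j : 'I_2, i != j ->
     left_inverse (T i) \o T j = T j \o left_inverse (T i)).

Definition monomial T (m n : nat) : H -> H := iter m (T 0) \o iter n (T 1).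

Definition analytic T : Prop :=
  \bigcap_(mn in [set: nat * nat]) (monomial T mn.1 mn.2 @` setT) = [set 0].

Definition joint_ker_adjoint T : set H :=
  ker (adjoint (T 0)) `&` ker (adjoint (T 1)).

End Operators.

(* Main.v *)
Require Import Defs.
From mathcomp Require Import all_boot all_order all_algebra.
From mathcomp Require Import complex.
From mathcomp Require Import all_classical all_reals all_analysis.
Import Order.TTheory GRing.Theory Num.Theory.
Import numFieldNormedType.Exports.
Local Open Scope classical_set_scope.
Local Open Scope ring_scope.

(** Call [u] and [v] torally orthogonal when [u _|_ v], [T_1 u _|_ T_1 v] and
    [T_2 u _|_ T_2 v].  Paired with two vectors, the toral equation reads
      [<T_i T_j u, T_i T_j v> = <T_i u, T_i v> + <T_j u, T_j v> - <u, v>],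
    so toral orthogonality passes from [(u, v)] to [(T_j u, T_j v)]
    ([toral_orthogonal_step]).  Factors common to two monomials can therefore
    be cancelled, and it suffices to treat [T^a x] and [T^b y] with [x], [y] in
    the joint kernel, [a <> b], and [a], [b] of disjoint supports
    ([toral_orthogonal_disjoint]).

    Exchanging the two vectors if necessary, let [i] be an index with [a_i > 0],
    so that [b_i = 0], and let [j] be the other index.  Since [ker L_i = ker T_i^*], commutation of [L_i] with [T_j]
    says that [T_j] preserves [ker T_i^*] ([ker_adjoint_stable]).  Hence [T^b y]
    and [T_j T^b y] lie in [ker T_i^*], whereas [T^a x] and [T_j T^a x] lie in
    the range of [T_i]: this settles two of the three orthogonality relations.
    For the third, [T_i T^a x _|_ T_i T^b y], there are two cases.  If [b = 0],
    then [T_i^* T_i y] is in the joint kernel by assumption, hence orthogonal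
    to the range of [T_i].  If [b_j > 0], then [a_j = 0], so [T_i T^a x] is a
    power of [T_i] applied to [x] and lies in [ker T_j^*], while [T_i T^b y]
    lies in the range of [T_j]. *)

Lemma ord2_neq (i j k : 'I_2) : i != j -> k != i -> k = j.
Proof.
by case: i j k => [[|[|//]] ?] [[|[|//]] ?] [[|[|//]] ?] // _ _; apply: val_inj.
Qed.

Section ToralPair.
Context {R : realType} {H : hilbertSpace R}.
Implicit Types (T : 'I_2 -> {linear H -> H}) (u v x y : H).

Lemma inner_eq0C u v : '[u, v] = 0 -> '[v, u] = 0.
Proof. by move=> uv0; rewrite hermC /= uv0 rmorph0 mulr0. Qed.

(** If [T_i] had no adjoint, then [adjoint (T i)] would be the default value 0
    and the toral equation for [(i, i)] would reduce to [x = 0]: the space would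
    be trivial and the identity would still hold. *)
Lemma toral_adjointE T : toral_2_isometry T ->
  forall i x y, '[T i x, y] = '[x, adjoint (T i) y].
Proof.
move=> toral i; have [adjT|noadj] := pselect (exists B : H -> H,
  forall x y, '[T i x, y] = '[x, B y]).
  exact: (xgetPex (fun=> 0) adjT).
have adj0 : adjoint (T i) = fun=> 0.
  by apply: xgetPN => B adjB; apply: noadj; exists B.
move=> x y; have := toral i i y; rewrite adj0 !subr0 addr0 => ->.
by rewrite !linear0r.
Qed.

(** [L = (A^* A)^-1 A^*] with an injective linear first factor. *)
Lemma left_inverse_eq0 (A : H -> H) x :
  left_invertible A -> Defs.left_inverse A x = 0 <-> adjoint A x = 0.
Proof.
move=> [B [_ AK BK]].
have [_ invK] : cancel (adjoint A \o A) (op_inverse (adjoint A \o A)) /\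
    cancel (op_inverse (adjoint A \o A)) (adjoint A \o A).
  have := @xgetPex _ (fun=> 0) [set B' : H -> H |
    cancel (adjoint A \o A) B' /\ cancel B' (adjoint A \o A)].
  by apply; exists (B : H -> H).
have invE z : op_inverse (adjoint A \o A) z = B z by rewrite -[LHS]AK invK.
rewrite /Defs.left_inverse /= invE; split=> [Bx0|->]; last exact: linear0.
by apply: (can_inj BK); rewrite Bx0 linear0.
Qed.

Lemma ker_adjoint_stable T i j : left_inverse_commuting T -> i != j ->
  forall n x, adjoint (T i) x = 0 -> adjoint (T i) (iter n (T j) x) = 0.
Proof.
move=> [linv lic] ij n x x0; elim: n => //= n IHn.
apply/(left_inverse_eq0 _ _ (linv i)).
have /= -> := congr1 (fun f => f (iter n (T j) x)) (lic i j ij).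
by rewrite (proj2 (left_inverse_eq0 _ _ (linv i)) IHn) linear0.
Qed.

Lemma commuting_iter T i j : commuting_pair T ->
  forall n x, iter n (T i) (T j x) = T j (iter n (T i) x).
Proof.
move=> comm n x; elim: n => //= n ->.
exact: (congr1 (fun f => f (iter n (T i) x)) (comm i j)).
Qed.

Lemma commuting_iter_iter T i j : commuting_pair T ->
  forall m n x, iter m (T i) (iter n (T j) x) = iter n (T j) (iter m (T i) x).
Proof. by move=> comm m n x; elim: n => //= n <-; apply: commuting_iter. Qed.

Lemma monomialD T : commuting_pair T -> forall k l m n x,
  monomial T (k + m) (l + n) x = monomial T k l (monomial T m n x).
Proof.
move=> comm k l m n x; rewrite /monomial /= !iterD.
by rewrite (commuting_iter_iter T 0 1 comm m l).
Qed.

Definition toral_orthogonal T u v : Prop :=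
  '[u, v] = 0 /\ forall i, '[T i u, T i v] = 0.

Lemma toral_orthogonalC T u v :
  toral_orthogonal T u v -> toral_orthogonal T v u.
Proof. by move=> [uv Tuv]; split=> [|i]; apply: inner_eq0C. Qed.

Lemma toral_orthogonal_step T j u v : toral_2_isometry T ->
  toral_orthogonal T u v -> toral_orthogonal T (T j u) (T j v).
Proof.
move=> toral [uv Tuv]; split=> // i; have adjE := toral_adjointE T toral.
have := congr1 (fun w => '[u, w]) (toral i j v).
by rewrite /= linearDr !linearBr linear0r /= -!adjE uv !Tuv !subr0 add0r.
Qed.

Lemma toral_orthogonal_monomial T k l u v : toral_2_isometry T ->
  toral_orthogonal T u v ->
  toral_orthogonal T (monomial T k l u) (monomial T k l v).
Proof.
move=> toral uv; rewrite /monomial /=; elim: k => [|k IHk] /=.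
  by elim: l => //= l IHl; apply: toral_orthogonal_step.
exact: toral_orthogonal_step.
Qed.

Lemma joint_kerP T x :
  joint_ker_adjoint T x <-> forall i, adjoint (T i) x = 0.
Proof.
split=> [[x0 x1] i|x0]; last by split; apply: x0.
by have [-> //|i0] := eqVneq i 0; rewrite (ord2_neq 0 1 i).
Qed.

(** The disjunction on [b] and [d] makes the supports of the two exponents
    disjoint; it also separates the two arguments for the relation
    [T_i u _|_ T_i v], the only one that uses the invariance of the joint
    kernel under [T_i^* T_i]. *)
Lemma toral_orthogonal_disjoint T i j a b d x y :
  commuting_pair T -> left_inverse_commuting T -> toral_2_isometry T ->
  (forall k, (adjoint (T k) \o T k) @` joint_ker_adjoint T
               `<=` joint_ker_adjoint T) ->
  i != j -> joint_ker_adjoint T x -> joint_ker_adjoint T y ->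
  b = 0%N \/ d = 0%N ->
  toral_orthogonal T (iter a.+1 (T i) (iter b (T j) x)) (iter d (T j) y).
Proof.
move=> comm lic toral Tker ij Ex Ey bd.
have adjE := toral_adjointE T toral.
have /joint_kerP x0 := Ex; have /joint_kerP y0 := Ey.
have Tiy n : adjoint (T i) (iter n (T j) y) = 0.
  exact: ker_adjoint_stable.
split=> [|k]; first by rewrite /= adjE Tiy linear0r.
have [->|ki] := eqVneq k i; last first.
  rewrite (ord2_neq _ _ _ ij ki).
  rewrite -[T j (iter a.+1 _ _)](commuting_iter T i j comm a.+1) /= adjE.
  by rewrite -[T j (iter d _ _)]/(iter d.+1 (T j) y) Tiy linear0r.
case: d bd Tiy => [_ _|d [->|//] _] /=.
  have /joint_kerP Ay0 : joint_ker_adjoint T (adjoint (T i) (T i y)).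
    by apply: Tker; exists y.
  by rewrite adjE [LHS]adjE Ay0 linear0r.
apply: inner_eq0C.
rewrite -[T i (T j _)](commuting_iter T j i comm d.+1) /= adjE.
rewrite -[T i (T i _)]/(iter a.+2 (T i) x).
by rewrite ker_adjoint_stable ?linear0r // eq_sym.
Qed.

End ToralPair.

Theorem theorem12 (R : realType) (H : hilbertSpace R)
    (T : 'I_2 -> {linear H -> H})
    (T_bounded : forall i : 'I_2, bounded_operator (T i))
    (T_comm : commuting_pair T)
    (T_lic : left_inverse_commuting T)
    (T_analytic : analytic T)
    (T_toral : toral_2_isometry T)
    (T_ker : forall j : 'I_2,
       (adjoint (T j) \o T j) @` joint_ker_adjoint T `<=` joint_ker_adjoint T)
    (m n p q : nat) :
  (m, n) != (p, q) ->
  perp (monomial T m n @` joint_ker_adjoint T)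
       (monomial T p q @` joint_ker_adjoint T).
Proof.
move=> mnpq _ _ [x Ex <-] [y Ey <-].
(* Orthogonality is symmetric, so (m, n) may be taken to be the
   lexicographically larger exponent. *)
wlog lex : m n p q x y Ex Ey mnpq / (p < m)%N || ((p == m) && (q < n)%N).
  move=> wlg.
  have fwd := wlg m n p q x y Ex Ey mnpq.
  have bwd : (m < p)%N || ((m == p) && (n < q)%N) ->
      '[monomial T m n x, monomial T p q y] = 0.
    move=> lt; apply: inner_eq0C; apply: (wlg p q m n) lt => //.
    by rewrite eq_sym.
  case: (ltngtP p m) mnpq fwd bwd => [_ _ + _|_ _ _|->]; [exact|exact|].
  by case: (ltngtP q n) => [_ _ + _|_ _ _|->]; [exact|exact|rewrite eqxx].
have disjoint := toral_orthogonal_disjoint T.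
(* The exponent common to both monomials is (p, min n q), or (m, q) when
   m = p. *)
suff [] : toral_orthogonal T (monomial T m n x) (monomial T p q y) by [].
case/orP: lex => [pm|/andP[/eqP-> qn]].
  have bd : (n - minn n q = 0)%N \/ (q - minn n q = 0)%N.
    by case: (leqP n q) => _; rewrite subnn; [left|right].
  have := disjoint 0 1 (m - p).-1 _ _ x y T_comm T_lic T_toral T_ker isT
    Ex Ey bd.
  move=> /(toral_orthogonal_monomial T p (minn n q) _ _ T_toral).
  rewrite -[iter _.+1 _ _]/(monomial T (m - p).-1.+1 _ x).
  rewrite -[iter (q - _) _ _]/(monomial T 0 _ y) -!monomialD // addn0.
  by rewrite !subnKC ?geq_minl ?geq_minr // prednK ?subn_gt0 // subnKC // ltnW.
have := disjoint 1 0 (n - q).-1 0%N 0%N x y T_comm T_lic T_toral T_ker isT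
  Ex Ey (or_introl erefl).
move=> /(toral_orthogonal_monomial T m q _ _ T_toral).
rewrite -[iter _.+1 _ _]/(monomial T 0 (n - q).-1.+1 x).
rewrite -[iter 0 _ y]/(monomial T 0 0 y) -!monomialD // !addn0.
by rewrite prednK ?subn_gt0 // subnKC // ltnW.
Qed.
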